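(* Let $R$ be a finite commutative Frobenius ring with unity, $|R|=\ell$, let $b,n\ge 1$ and $1\le t\le b$ be integers, and let $C\subseteq R^{nb}$ be a byte error-control code (linear code) with byte length $b$. Let $A_{(\alpha_0,\ldots,\alpha_b)}$ and $A^{\perp}_{(\alpha_0,\ldots,\alpha_b)}$ denote the numbers of codewords of $C$ and of $C^\perp$, respectively, with Hamming weight distribution vector $(\alpha_0,\ldots,\alpha_b)$, and let $W^\perp(z)=\sum_{\mathbf v\in C^\perp}z^{w_M(\mathbf v)}$ be the $m$-spotty Hamming weight enumerator of the dual code $C^\perp$. Then $$W^\perp(z)=\sum_{\substack{\alpha_0,\ldots,\alpha_b\ge 0\\ \alpha_0+\cdots+\alpha_b=n}}A^\perp_{(\alpha_0,\ldots,\alpha_b)}\prod_{j=0}^{b}\bigl(z^{\lceil j/t\rceil}\bigr)^{\alpha_j}=\frac1{|C|}\sum_{\substack{\alpha_0,\ldots,\alpha_b\ge 0\\ \alpha_0+\cdots+\alpha_b=n}}A_{(\alpha_0,\ldots,\alpha_b)}\prod_{j=0}^{b}\bigl(\vartheta_j^{(b,\ell)}(z)\bigr)^{\alpha_j},$$ where $$\vartheta_j^{(b,\ell)}(z)=\sum_{j_1=0}^{j}\sum_{j_2=0}^{b-j}(-1)^{j_1}(\ell-1)^{j_2}\binom{j}{j_1}\binom{b-j}{j_2}z^{\lceil (j_1+j_2)/t\rceil}.$$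
   Context: A finite commutative ring $R$ is Frobenius if it is self-injective; equivalently $(C^\perp)^\perp=C$ for every submodule $C\subseteq R^N$ and every $N$. A byte error-control code of length $N=nb$ and byte length $b$ is a linear code, i.e. an $R$-submodule $C\subseteq R^{nb}$; a vector is written $\mathbf c=(\mathbf c_1,\ldots,\mathbf c_n)$ with bytes $\mathbf c_i\in R^b$. The dual is $C^\perp=\{\mathbf v\in R^{nb}:\langle \mathbf u,\mathbf v\rangle=0\ \text{for all }\mathbf u\in C\}$, with the Euclidean inner product $\langle\mathbf u,\mathbf v\rangle=\sum_{i=1}^n\sum_{j=1}^b u_{i,j}v_{i,j}$. The Hamming weight $w_H(\mathbf x)$ of $\mathbf x\in R^b$ is its number of nonzero coordinates. The $m$-spotty Hamming weight of $\mathbf c$ is $w_M(\mathbf c)=\sum_{i=1}^n\lceil w_H(\mathbf c_i)/t\rceil$. The Hamming weight distribution vector of $\mathbf c$ is $(\alpha_0,\ldots,\alpha_b)$ with $\alpha_j=\#\{i: 1\le i\le n,\ w_H(\mathbf c_i)=j\}$. *)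

(* Defs.v *)
From HB Require Import structures.
From mathcomp Require Import all_boot all_order all_algebra.

Set Implicit Arguments.
Unset Strict Implicit.
Unset Printing Implicit Defensive.

Import Order.TTheory GRing.Theory Num.Theory.
Local Open Scope ring_scope.

Definition injective_module (R : pzRingType) (Q : lmodType R) : Prop :=
  forall (M N : lmodType R) (f : {linear M -> N}) (g : {linear M -> Q}),
    injective f -> exists h : {linear N -> Q}, forall x : M, h (f x) = g x.

(* Frobenius is self-injective for finite commutative rings.  The zero ring is
   not excluded. *)
Definition frobenius (R : finComPzRingType) : Prop :=
  @injective_module R (R^o : lmodType R).

(* R^(nb) is 'M[R]_(n, b): the bytes of a word are the rows of the matrix. *)

Definition linear_code (R : finComPzRingType) (n b : nat)
    (C : {set 'M[R]_(n, b)}) : Prop :=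
  GRing.submod_closed C.

Definition inner_product (R : finComPzRingType) (n b : nat)
    (u v : 'M[R]_(n, b)) : R :=
  \sum_(i < n) \sum_(j < b) u i j * v i j.

Definition dual_code (R : finComPzRingType) (n b : nat)
    (C : {set 'M[R]_(n, b)}) : {set 'M[R]_(n, b)} :=
  [set v | [forall u in C, inner_product u v == 0]].

(* The quotient is nonnegative, so the absolute value only casts to nat. *)
Definition ceil_div (m t : nat) : nat := `|Num.ceil (m%:R / t%:R : rat)|%N.

Definition hamming_weight (R : finComPzRingType) (b : nat)
    (x : 'rV[R]_b) : nat :=
  #|[set j : 'I_b | x 0 j != 0]|.

Definition mspotty_weight (t : nat) (R : finComPzRingType) (n b : nat)
    (c : 'M[R]_(n, b)) : nat :=
  (\sum_(i < n) ceil_div (hamming_weight (row i c)) t)%N.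

Definition hamming_distribution (R : finComPzRingType) (n b : nat)
    (c : 'M[R]_(n, b)) (j : 'I_b.+1) : nat :=
  #|[set i : 'I_n | hamming_weight (row i c) == j]|.

(* A tuple (alpha_0, ..., alpha_b) of naturals with sum n has entries at most n,
   so it is a finite function from 'I_b.+1 to 'I_n.+1. *)
Definition distribution_count (R : finComPzRingType) (n b : nat)
    (C : {set 'M[R]_(n, b)}) (alpha : {ffun 'I_b.+1 -> 'I_n.+1}) : nat :=
  #|[set c in C | [forall j, hamming_distribution c j == alpha j]]|.

Definition mspotty_enumerator (t : nat) (R : finComPzRingType) (n b : nat)
    (C : {set 'M[R]_(n, b)}) : {poly rat} :=
  \sum_(v in C) 'X^(mspotty_weight t v).

Definition vartheta (t b l j : nat) : {poly rat} :=
  \sum_(0 <= j1 < j.+1) \sum_(0 <= j2 < (b - j).+1)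
    ((-1) ^+ j1 * (l%:R - 1) ^+ j2 * 'C(j, j1)%:R * 'C(b - j, j2)%:R)
      *: 'X^(ceil_div (j1 + j2) t).

(* Main.v *)
(* No generating character is used.  If a submodule D is enlarged by a minimal
   step D' = D + Rx, then m = (D : x) is a maximal ideal, v |-> <x, v> maps D^perp
   to ann(m) with kernel D'^perp, and self-injectivity makes ann(m) either zero or
   principal and isomorphic to R/m.  Hence |D| |D^perp| can only grow with D; as it
   is |R|^(nb) both for D = 0 and for the whole space, it is always |R|^(nb).
   Applied to C plus all the words vanishing on a set S of coordinates, this relates
   the number of words of C^perp supported in S to the number of words of C
   vanishing on S.  Inclusion-exclusion over S counts the words of C^perp by
   support, and sums over supports factor through the bytes. *)
Require Import Defs.
From HB Require Import structures.
From mathcomp Require Import all_boot all_order all_algebra.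
From mathcomp Require Import ring.

Set Implicit Arguments.
Unset Strict Implicit.
Unset Printing Implicit Defensive.

Import Order.TTheory GRing.Theory Num.Theory.
Local Open Scope ring_scope.

(** * Principal ideals and self-injectivity *)

Section PrincipalIdeal.

Variables (R : finComPzRingType) (x : R).

Definition principal_ideal : {pred R^o} := [pred w | [exists r, w == r * x]].

Lemma principal_idealP w :
  reflect (exists r, w = r * x) (w \in principal_ideal).
Proof. exact: 'exists_eqP. Qed.

Lemma principal_ideal_submod : GRing.submod_closed principal_ideal.
Proof.
split=> [|a u v]; first by apply/principal_idealP; exists 0; rewrite mul0r.
move=> /principal_idealP[r ->] /principal_idealP[s ->].
by apply/principal_idealP; exists (a * r + s); rewrite mulrDl -mulrA.
Qed.

(** A subtype of [R^o], so that the ideal inherits the [lmodType] structure that [injective_module]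
    asks of its source. *)
Record principal := Principal
  { principal_val :> R^o; principal_mem : principal_val \in principal_ideal }.

HB.instance Definition _ := [isSub for principal_val].
HB.instance Definition _ := [Choice of principal by <:].
HB.instance Definition _ := GRing.SubChoice_isSubLmodule.Build R R^o
  principal_ideal principal (GRing.submod_closed_semi principal_ideal_submod).

End PrincipalIdeal.

(** The map [r * x |-> r * y] on the ideal [R x] is well defined by hypothesis. Self-injectivity
    extends it to [R], where a linear map is multiplication by its value at [1]. *)
Lemma frobenius_extend (R : finComPzRingType) (hR : frobenius R) (x y : R) :
  (forall r, r * x = 0 -> r * y = 0) -> exists h, y = h * x.
Proof.
move=> ann_xy.
have ex (w : principal x) : exists r, val w == r * x.
  by have /principal_idealP[r wr] := principal_mem w; exists r; apply/eqP.
(* The coefficient [c w] is an arbitrary choice; [gE] shows that [g] does not depend on it. *)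
pose c w := xchoose (ex w); have cE w : val w = c w * x := eqP (xchooseP (ex w)).
move: c cE => c cE {ex}; pose g w : R^o := c w * y.
have gE (w : principal x) r : val w = r * x -> g w = r * y.
  move=> w_rx; apply/eqP; rewrite -subr_eq0 -mulrBl ann_xy //.
  by rewrite mulrBl -w_rx -cE subrr.
have g_lin : linear g.
  move=> a u v; rewrite (gE _ (a * c u + c v)).
    by rewrite mulrDl -mulrA.
  have -> : val (a *: u + v) = a * val u + val v by exact: linearP.
  by rewrite !cE mulrDl mulrA.
pose g_isLinear := GRing.isLinear.Build _ _ _ _ _ g_lin.
pose gL : {linear principal x -> R^o} := HB.pack g g_isLinear.
have [h hE] := hR _ _ (val : {linear principal x -> R^o}) gL val_inj.
have x_in : x \in principal_ideal x.
  by apply/principal_idealP; exists 1; rewrite mul1r.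
exists (h 1); have := hE (Principal x_in); rewrite /= /gL /= => hx.
have := gE (Principal x_in) 1; rewrite !mul1r => <- //.
by rewrite -hx -[x in h x]mulr1 -[x * 1]/(x *: (1 : R^o)) linearZ /= mulrC.
Qed.

(** * Counting by images, kernels and annihilators *)

Lemma card_equal_fibers (U V : finType) (f : U -> V) (A : {set U}) (k : nat) :
  (forall x, x \in A -> #|[set y in A | f y == f x]| = k) ->
  #|A| = (#|f @: A| * k)%N.
Proof.
move=> fibk; rewrite -sum1_card (partition_big_imset f) -sum_nat_const /=.
apply: eq_bigr => _ /imsetP[x xA ->]; rewrite -(fibk x xA) -sum1_card.
by apply: eq_bigl => y; rewrite inE.
Qed.

(** The fibre in [A] through [x] is the kernel translated by [x]. *)
Lemma card_image_kernel (U V : finZmodType) (f : U -> V) (A : {set U}) :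
  {morph f : x y / x - y} -> zmod_closed A ->
  #|A| = (#|f @: A| * #|[set x in A | f x == 0%R]|)%N.
Proof.
move=> fB [A0 AB]; apply: card_equal_fibers => x xA.
rewrite -[RHS](card_imset _ (addIr x)); apply: eq_card => y; rewrite inE.
apply/andP/imsetP => [[yA /eqP fy]|[z + ->]].
  by exists (y - x); rewrite ?subrK // inE AB // fB fy subrr eqxx.
rewrite inE => /andP[zA /eqP fz]; split; last first.
  by rewrite -subr_eq0 -fB addrK fz.
have AN w : w \in A -> - w \in A by move=> wA; rewrite -sub0r AB.
by rewrite -[x]opprK AB // AN.
Qed.
(** Lets [card_image_kernel] apply to maps on pairs, as in [card_adjoin]. *)
HB.instance Definition _ (U V : finZmodType) := Finite.on (U * V)%type.

(** The hypothesis makes every element outside [m] invertible modulo [m]. If some [z != 0]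
    annihilates [m], then [m] is exactly the annihilator of [z], so [frobenius_extend] makes
    everything annihilated by [m] a multiple of [z]; the bound is then read off the image and kernel
    of [r |-> r * z]. *)
Lemma card_annihilator (R : finComPzRingType) (hR : frobenius R) (m : {set R}) :
  (forall r, r \notin m -> exists s, 1 - s * r \in m) ->
  (#|[set z : R | [forall r in m, (r * z == 0)%R]]| * #|m| <= #|R|)%N.
Proof.
move=> m_max; set A := [set z | _].
have A_ann z r : z \in A -> r \in m -> r * z = 0.
  by rewrite inE => /forall_inP/(_ r)/[apply]/eqP.
have [z /andP[zA z_neq0]|A0] := pickP [pred z | (z \in A) && (z != 0)]; last first.
  have A_le1 : (#|A| <= 1)%N.
    rewrite -(cards1 (0 : R)); apply/subset_leq_card/subsetP => z zA.
    by move: (A0 z); rewrite /= zA in_set1 /=; case: eqP.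
  by rewrite -[#|R|]mul1n leq_mul ?max_card.
have ker_z r : r * z = 0 -> r \in m.
  move=> rz0; apply: contraNT z_neq0 => /m_max[s sm].
  (* In [z = (1 - s * r) * z + s * r * z] both terms vanish. *)
  by rewrite -[z]mul1r -[1](subrK (s * r)) mulrDl A_ann // -mulrA rz0 mulr0 addr0.
rewrite -[#|R|]cardsT [leqRHS](card_image_kernel (f := *%R^~ z)) => [||]; first last.
- by split=> [|? ? _ _]; rewrite inE.
- by move=> r s; rewrite mulrBl.
apply: leq_mul; apply/subset_leq_card/subsetP => y yA; last first.
  by rewrite !inE A_ann ?eqxx.
have [|h ->] := @frobenius_extend R hR z y; last by apply: imset_f; rewrite inE.
by move=> r /ker_z rm; apply: A_ann.
Qed.

(** * Cardinality of the dual code *)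

Section Duality.

Variables (R : finComPzRingType) (n b : nat).
Local Notation V := 'M[R]_(n, b).
Implicit Types (C D E : {set V}) (u v x : V).

Lemma inner_productC u v : inner_product u v = inner_product v u.
Proof. by do 2![apply: eq_bigr => ? _]; rewrite mulrC. Qed.

Lemma inner_product_linear a u x v :
  inner_product (a *: u + x) v = a * inner_product u v + inner_product x v.
Proof.
rewrite /inner_product big_distrr -big_split; apply: eq_bigr => i _ /=.
rewrite big_distrr -big_split; apply: eq_bigr => j _ /=.
by rewrite !mxE mulrDl mulrA.
Qed.

Lemma inner_productBr u v x :
  inner_product u (v - x) = inner_product u v - inner_product u x.
Proof.
rewrite addrC -scaleN1r inner_productC inner_product_linear mulN1r addrC.
by rewrite !(inner_productC u).
Qed.

Lemma inner_product_delta i j v : inner_product (delta_mx i j) v = v i j.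
Proof.
rewrite /inner_product (bigD1 i) //= (bigD1 j) //= mxE !eqxx mul1r.
rewrite !big1 ?addr0 // => [i' i'i|j' j'j].
  by rewrite big1 // => j' _; rewrite mxE (negPf i'i) mul0r.
by rewrite mxE (negPf j'j) andbF mul0r.
Qed.

Lemma dual_codeP D v :
  reflect (forall u, u \in D -> inner_product u v = 0) (v \in dual_code D).
Proof. by rewrite inE; apply: 'forall_in_eqP. Qed.

Lemma dual_code_zmod D : zmod_closed (dual_code D).
Proof.
split=> [|v x /dual_codeP vD /dual_codeP xD].
  apply/dual_codeP => u _; rewrite /inner_product big1 // => i _.
  by rewrite big1 // => j _; rewrite mxE mulr0.
by apply/dual_codeP => u uD; rewrite inner_productBr vD // xD // subrr.
Qed.

Definition adjoin D x : {set V} :=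
  [set p.1 *: x + p.2 | p in setX [set: R] D].

Section Adjoin.

Variables (D : {set V}) (x : V).
Hypothesis modD : linear_code D.

Let D0 : 0 \in D := modD.1.
Let D_lin a u v : u \in D -> v \in D -> a *: u + v \in D := @modD.2 a u v.

Lemma mem_adjoin r v : v \in D -> r *: x + v \in adjoin D x.
Proof. by move=> vD; apply/imsetP; exists (r, v) => //; rewrite !inE. Qed.

Lemma adjoinP w :
  reflect (exists r, exists2 v, v \in D & w = r *: x + v) (w \in adjoin D x).
Proof.
apply: (iffP imsetP) => [[[r v] /setXP[_ vD] ->]|[r [v vD ->]]].
  by exists r, v.
by exists (r, v) => //; rewrite !inE.
Qed.

Lemma adjoin_id : x \in adjoin D x.
Proof. by rewrite -[x in x \in _]addr0 -[x in x + 0]scale1r mem_adjoin. Qed.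

Lemma sub_adjoin : D \subset adjoin D x.
Proof. by apply/subsetP => v vD; rewrite -[v]add0r -(scale0r x) mem_adjoin. Qed.

Lemma linear_code_adjoin : linear_code (adjoin D x).
Proof.
split=> [|a _ _ /adjoinP[r [u uD ->]] /adjoinP[s [v vD ->]]].
  exact: (subsetP sub_adjoin).
rewrite scalerDr scalerA addrACA -scalerDl; apply: mem_adjoin; exact: D_lin.
Qed.

(** The map [(r, v) |-> r *: x + v] sends pairs with [v] in [D] onto [adjoin D x]; its kernel is the
    graph of [r |-> - (r *: x)] over the [r] with [r *: x] in [D]. *)
Lemma card_adjoin :
  (#|R| * #|D| = #|adjoin D x| * #|[set r : R | r *: x \in D]|)%N.
Proof.
rewrite -[#|R|]cardsT -cardsX (card_image_kernel (f := fun p => p.1 *: x + p.2)).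
- congr (_ * _)%N.
  rewrite -[RHS](card_imset (f := fun r => (r, - (r *: x)))); last by move=> ? ? [].
  apply: eq_card => -[r v]; rewrite !inE /=; apply/andP/imsetP => [[vD]|[s]].
    rewrite addr_eq0 => /eqP rxE; exists r; last by rewrite rxE opprK.
    by rewrite inE rxE -scaleN1r -[_ *: v]addr0 D_lin.
  rewrite inE => sxD [-> ->]; rewrite subrr eqxx; split=> //.
  by rewrite -scaleN1r -[_ *: _]addr0 D_lin.
- by move=> [r u] [s v] /=; rewrite scalerBl opprD addrACA.
split=> [|[r u] [s v]]; rewrite !inE //= => uD vD.
by rewrite addrC -scaleN1r D_lin.
Qed.

End Adjoin.

Arguments adjoinP {D x w}.

Hypothesis hR : frobenius R.

Lemma card_dual_adjoin D x : linear_code D ->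
    (forall r, r *: x \notin D -> x \in adjoin D (r *: x)) ->
  (#|D| * #|dual_code D| <= #|adjoin D x| * #|dual_code (adjoin D x)|)%N.
Proof.
move=> modD x_min; have R_gt0 : (0 < #|R|)%N by apply/card_gt0P; exists 0.
set m := [set r : R | r *: x \in D].
have dual_split : #|dual_code D|
    = (#|inner_product x @: dual_code D| * #|dual_code (adjoin D x)|)%N.
  rewrite (card_image_kernel (f := inner_product x)) => [||]; first last.
  - exact: dual_code_zmod.
  - exact: inner_productBr.
  congr (_ * _)%N; apply: eq_card => v; rewrite inE.
  apply/andP/dual_codeP => [[/dual_codeP vD /eqP xv0] _ /adjoinP[r [u uD ->]]|v0].
    by rewrite inner_product_linear xv0 mulr0 add0r vD.
  split; last by rewrite v0 // adjoin_id.
  by apply/dual_codeP => u uD; rewrite v0 // (subsetP (sub_adjoin _ _)).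
have image_le : (#|inner_product x @: dual_code D| * #|m| <= #|R|)%N.
  apply: leq_trans (card_annihilator hR (m := m) _) => [|r].
    rewrite leq_mul2r; apply/orP; right; apply/subset_leq_card/subsetP => z.
    case/imsetP => v /dual_codeP vD ->; rewrite inE; apply/forall_inP => r.
    rewrite inE => rxD; rewrite -[_ * _]addr0 -(vD 0 modD.1) -inner_product_linear.
    by rewrite addr0 !vD ?modD.1.
  (* From [x = s *: (r *: x) + v] follows [(1 - s * r) *: x = v], which is in [D]: minimality of the
     step makes [r] invertible modulo [m]. *)
  rewrite inE => /x_min/adjoinP[s [v vD xE]]; exists s.
  by rewrite inE scalerBl scale1r -scalerA {1}xE [_ + v]addrC addrK.
(* Scaling by [#|R|] avoids division: [card_adjoin] turns [#|R| * #|D|] into [#|adjoin D x| * #|m|],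
   and [image_le] applies. *)
rewrite -(leq_pmul2l R_gt0) mulnA (card_adjoin x modD) -/m dual_split [leqRHS]mulnCA.
by rewrite -mulnA leq_mul2l mulnA leq_mul2r [(#|m| * _)%N]mulnC image_le !orbT.
Qed.

(** An [x] with [adjoin D x] of least cardinality works: if [r *: x] is outside [D], then
    [adjoin D (r *: x)] lies in [adjoin D x] and cannot be smaller. *)
Lemma exists_minimal_adjoin D E : linear_code D -> linear_code E -> D \proper E ->
  exists2 x, x \in E :\: D & forall r, r *: x \notin D -> x \in adjoin D (r *: x).
Proof.
move=> modD modE /properP[_ [y yE yD]].
have y_in : y \in E :\: D by rewrite inE yD.
have [x xED x_min] := arg_minnP (P := mem (E :\: D)) (fun x => #|adjoin D x|) y_in.
exists x => // r rxD.
have sub_rx : adjoin D (r *: x) \subset adjoin D x.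
  apply/subsetP => _ /adjoinP[s [v vD ->]].
  by rewrite scalerA mem_adjoin.
have [rxE|rxE] := boolP (r *: x \in E); last first.
  by case/negP: rxE; rewrite -[_ *: _]addr0 modE.2 ?modE.1 // (setDP xED).1.
have /eqP-> : adjoin D (r *: x) == adjoin D x.
  by rewrite eqEcard sub_rx x_min //; apply/setDP.
exact: adjoin_id.
Qed.

(** Induction on [#|E :\: D|], climbing from [D] to [E] by minimal steps. *)
Lemma card_dual_code_homo D E : linear_code D -> linear_code E -> D \subset E ->
  (#|D| * #|dual_code D| <= #|E| * #|dual_code E|)%N.
Proof.
move=> modD modE; have [k] := ubnP #|E :\: D|.
elim: k => // k IHk in D modD * => ltk sDE.
have [->//|neqDE] := eqVneq D E.
have [|x xED x_min] := @exists_minimal_adjoin D E modD modE.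
  by rewrite properEneq neqDE.
have [xE xD] : x \in E /\ x \notin D by move: xED; rewrite inE => /andP[].
apply: leq_trans (card_dual_adjoin modD x_min) (IHk _ _ _ _).
- exact: linear_code_adjoin.
- rewrite ltnS in ltk; apply: leq_trans ltk; apply: proper_card.
  apply/properP; split; first by rewrite setDS // sub_adjoin.
  by exists x; rewrite // !inE adjoin_id.
apply/subsetP => _ /adjoinP[r [v vD ->]].
by apply: modE.2; rewrite // (subsetP sDE).
Qed.

Lemma card_dual_code D : linear_code D ->
  (#|D| * #|dual_code D| = #|R| ^ (n * b))%N.
Proof.
move=> modD; have mod0 : linear_code [set (0 : V)].
  split=> [|a u v]; rewrite !inE // => /eqP-> /eqP->.
  by rewrite scaler0 addr0.
have modT : linear_code [set: V] by split=> [|? ? ? _ _]; rewrite in_setT.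
have cardV : #|[set: V]| = (#|R| ^ (n * b))%N by rewrite cardsT card_mx.
apply/eqP; rewrite eqn_leq -cardV; apply/andP; split.
  apply: leq_trans (card_dual_code_homo modD modT (subsetT _)) _.
  rewrite -[leqRHS]muln1 leq_mul2l; apply/orP; right.
  (* The dual of the whole space is zero: pairing with matrix units reads off every entry. *)
  rewrite -(cards1 (0 : V)); apply/subset_leq_card/subsetP => v /dual_codeP v0.
  rewrite inE; apply/eqP/matrixP => i j.
  by rewrite -(inner_product_delta i j v) v0 ?in_setT ?mxE.
apply: leq_trans (card_dual_code_homo mod0 modD _); last first.
  by rewrite sub1set modD.1.
rewrite cards1 mul1n; apply/subset_leq_card/subsetP => v _.
apply/dual_codeP => _ /set1P->; rewrite inner_productC.
(* Zero lies in the dual of [[set v]], so [inner_product v 0 = 0]. *)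
exact: (dual_codeP _ _ (dual_code_zmod [set v]).1 v (set11 v)).
Qed.

End Duality.

(** * Restricting a code and its dual to a set of coordinates *)

Section Shortening.

Variables (R : finComPzRingType) (n b : nat).
Local Notation V := 'M[R]_(n, b).
Local Notation P := ('I_n * 'I_b)%type.
Implicit Types (C : {set V}) (u v : V) (S : {set P}).

Definition support_mx v : {set P} := [set p | v p.1 p.2 != 0].

Definition mask S v : V := \matrix_(i, j) if (i, j) \in S then v i j else 0.

Lemma mask_linear S a u v : mask S (a *: u + v) = a *: mask S u + mask S v.
Proof. by apply/matrixP => i j; rewrite !mxE; case: ifP; rewrite ?mulr0 ?addr0. Qed.

Lemma maskB S : {morph mask S : u v / u - v}.
Proof. by move=> u v; rewrite addrC -scaleN1r mask_linear scaleN1r addrC. Qed.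

Lemma mask0 S : mask S 0 = 0.
Proof. by apply/matrixP => i j; rewrite !mxE if_same. Qed.

Lemma mask_eq0 S v : (mask S v == 0) = [disjoint support_mx v & S].
Proof.
rewrite disjoint_subset; apply/eqP/subsetP => [v0 [i j]|vS].
  rewrite !inE /=; apply: contraNN => ijS.
  by move/matrixP/(_ i j): v0; rewrite !mxE ijS => ->.
apply/matrixP => i j; rewrite !mxE; case: ifP => // ijS.
by apply: contraTeq ijS => vij; have := vS (i, j); rewrite !inE => ->.
Qed.

Lemma mask_id S v : (mask S v == v) = (support_mx v \subset S).
Proof.
apply/eqP/subsetP => [v_id [i j]|vS].
  by rewrite inE /= -v_id mxE; case: ifP => //; rewrite eqxx.
apply/matrixP => i j; rewrite !mxE; case: ifPn => // /(contra (vS (i, j))).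
by rewrite inE negbK => /eqP.
Qed.

Lemma card_mask S : #|mask S @: [set: V]| = (#|R| ^ #|S|)%N.
Proof.
(* Masked words correspond to the functions on positions with value [0] outside [S]. *)
rewrite -(card_pffun_on (0 : R) S predT).
pose g (f : {ffun P -> R}) : V := \matrix_(i, j) f (i, j).
have g_inj : injective g.
  move=> f1 f2 /matrixP eq_f; apply/ffunP => -[i j].
  by have := eq_f i j; rewrite !mxE.
rewrite -(card_imset _ g_inj); apply: eq_card => v.
apply/imsetP/imsetP => [[u _ ->]|[f /pffun_onP[fS _] ->]].
  exists [ffun p => mask S u p.1 p.2]; last first.
    by apply/matrixP => i j; rewrite !mxE ffunE mxE.
  apply/pffun_onP; split=> //; apply/supportP => -[i j] /negPf ijS.
  by rewrite ffunE mxE ijS.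
exists (g f) => //; apply/matrixP => i j; rewrite !mxE; case: ifPn => // ijS.
by rewrite (supportP fS).
Qed.

(* The code of all words agreeing on [S] with a codeword, i.e. [C] plus all the
   words vanishing on [S], has as dual the words of the dual of [C] supported
   in [S]. *)
Lemma card_dual_support (hR : frobenius R) C S : linear_code C ->
  (#|C| * #|[set v in dual_code C | support_mx v \subset S]|
    = #|R| ^ #|S| * #|[set u in C | [disjoint support_mx u & S]]|)%N.
Proof.
move=> modC; pose D : {set V} := [set v | mask S v \in mask S @: C].
have sCD : C \subset D by apply/subsetP => u uC; rewrite inE imset_f.
have modD : linear_code D.
  split=> [|a u v]; first by rewrite (subsetP sCD) ?modC.1.
  rewrite !inE => /imsetP[u' u'C uE] /imsetP[v' v'C vE].
  by rewrite mask_linear uE vE -mask_linear imset_f // modC.2.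
have zmodT : zmod_closed [set: V] by split=> [|? ? _ _]; rewrite in_setT.
(* [K] is the kernel of [mask S] both on [D] and on the whole space, so its cardinality cancels at
   the end. *)
pose K := [set v in [set: V] | mask S v == 0].
have D_split : #|D| = (#|mask S @: C| * #|K|)%N.
  rewrite (card_image_kernel (@maskB S) (GRing.submod_closedB modD)).
  congr (_ * _)%N; apply: eq_card => v.
    apply/imsetP/imsetP => [[u + ->]|[u uC ->]]; last first.
      by exists u; rewrite ?(subsetP sCD).
    by rewrite inE => /imsetP.
  rewrite !inE; case: eqP => [v0|_]; last by rewrite !andbF.
  by rewrite v0 -(mask0 S) imset_f ?modC.1.
have V_split : (#|R| ^ (n * b) = #|R| ^ #|S| * #|K|)%N.
  by rewrite -card_mask -card_mx -cardsT -(card_image_kernel (@maskB S) zmodT).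
have D_dual : dual_code D = [set v in dual_code C | support_mx v \subset S].
  apply/setP => v; rewrite inE -mask_id.
  apply/dual_codeP/andP => [vD|[/dual_codeP vC /eqP v_id] u].
    split; first by apply/dual_codeP => u uC; rewrite vD ?(subsetP sCD).
    apply/eqP/matrixP => i j; rewrite mxE; case: ifPn => // ijS.
    (* A matrix unit outside [S] is masked to zero, so it lies in [D] and forces [v i j = 0]. *)
    rewrite -inner_product_delta vD // inE.
    rewrite (_ : mask S _ = mask S 0) ?imset_f ?modC.1 //.
    apply/matrixP => i' j'; rewrite !mxE; case: ifP => // i'j'S.
    apply/eqP; case: andP => // -[/eqP i'i /eqP j'j].
    by rewrite -i'i -j'j i'j'S in ijS.
  rewrite inE => /imsetP[u' u'C uE].
  have mask_adj x : inner_product x v = inner_product (mask S x) v.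
    apply: eq_bigr => i _; apply: eq_bigr => j _.
    by rewrite -v_id !mxE; case: ifP; rewrite // !mulr0.
  by rewrite mask_adj uE -mask_adj vC.
have K_gt0 : (0 < #|K|)%N by apply/card_gt0P; exists 0; rewrite !inE mask0 eqxx.
have := card_dual_code hR modD; rewrite D_dual D_split V_split mulnAC => /eqP.
rewrite eqn_pmul2r // => /eqP <-; rewrite mulnAC; congr (_ * _)%N.
rewrite (card_image_kernel (@maskB S) (GRing.submod_closedB modC)).
by congr (_ * _)%N; apply: eq_card => u; rewrite !inE mask_eq0.
Qed.

End Shortening.

(** * MacWilliams identities, by support and by bytes *)

Section WeightEnumerator.

Variables (R : finComPzRingType) (n b : nat).
Local Notation V := 'M[R]_(n, b).
Local Notation P := ('I_n * 'I_b)%type.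
Implicit Types (C : {set V}) (u v : V) (S T W : {set P}).

(* What the sum of [chi(<u, v>)] over the words [v] of support [W] would be, for
   [u] of support [T] and [chi] a generating character of [R]. *)
Definition krawtchouk (I : finType) (T W : {set I}) : rat :=
  \prod_(p in W) (if p \in T then -1 else #|R|%:R - 1).

(** Inclusion-exclusion: the product is [(-1) ^+ #|W :\: S|] if [S \subset W] and [0] otherwise.
    Written position by position, the sum over [S] is an expanded product of local factors, each [1]
    or [0] as the support and [W] agree or not at [p]. *)
Lemma support_mx_eqE v W :
  (support_mx v == W)%:R = \sum_(S : {set P}) (support_mx v \subset S)%:R *
    \prod_p (if p \in S then (p \in W)%:R else (-1) ^+ (p \in W)) :> rat.
Proof.
transitivity (\prod_(p : P)
    ((p \in W)%:R + (p \notin support_mx v)%:R * (-1) ^+ (p \in W)) : rat).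
  have [<-|neq] := eqVneq.
    rewrite big1 // => p _.
    by case: (p \in _); rewrite /= ?(mul0r, addr0, add0r, mul1r).
  have /existsP[p ] : [exists p, (p \in support_mx v) != (p \in W)].
    apply: contraNT neq => /existsPn eqW; apply/eqP/setP => p.
    by apply/eqP; rewrite -[_ == _]negbK.
  rewrite (bigD1 p) //=.
  do 2![case: (p \in _)] => //= _;
    by rewrite ?(mul0r, add0r, mul1r, expr1, subrr).
rewrite bigA_distr; apply: eq_bigr => S _.
have [/subsetP vS|/subsetPn[p pv pS]] := boolP (_ \subset _).
  rewrite mul1r; apply: eq_bigr => p _; case: ifPn => // /(contra (vS p)) ->.
  by rewrite mul1r.
by rewrite mul0r (bigD1 p) //= (negPf pS) pv !mul0r.
Qed.

Lemma card_support_dual (hR : frobenius R) C W : linear_code C ->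
  (#|C| * #|[set v in dual_code C | support_mx v == W]|)%:R
    = \sum_(u in C) krawtchouk (support_mx u) W.
Proof.
move=> modC; rewrite natrM.
have card_sum (E : {set V}) (Q : pred V) :
    #|[set v in E | Q v]|%:R = \sum_(v in E) (Q v)%:R :> rat.
  rewrite -sum1_card natr_sum (eq_bigl (fun v => (v \in E) && Q v)) => [|v].
    by rewrite big_mkcondr; apply: eq_bigr => v _; case: (Q v).
  by rewrite inE.
rewrite card_sum; under eq_bigr => v _ do rewrite support_mx_eqE.
rewrite exchange_big /= big_distrr /=.
under eq_bigr => S _.
  rewrite -big_distrl /= -card_sum mulrA -natrM card_dual_support // natrM.
  rewrite card_sum -mulrA mulrCA big_distrl /=.
over.
rewrite exchange_big /=; apply: eq_bigr => u _.
(* The sum over [S] is folded back into a product: [p] in [S] contributes the first term, with one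
   factor [#|R|] from [#|R| ^ #|S|], and [p] outside [S] the sign. *)
transitivity (\prod_(p : P) ((p \in W)%:R * (p \notin support_mx u)%:R * #|R|%:R
    + (-1) ^+ (p \in W)) : rat).
  rewrite bigA_distr; apply: eq_bigr => S _.
  have [uS|] := boolP [disjoint _ & _]; last first.
    rewrite disjoint_subset => /subsetPn[p pu]; rewrite !inE negbK => pS.
    by rewrite mul0r (bigD1 p) //= pS pu mulr0 !mul0r.
  rewrite mul1r natrX -prodr_const (big_mkcond (mem S)) -big_split /=.
  apply: eq_bigr => p _; case: ifP => [pS|_]; last by rewrite mul1r.
  rewrite (_ : p \notin support_mx u) ?mulr1 1?mulrC //.
  by apply: contraTN pS => /(disjointFr uS) ->.
rewrite /krawtchouk [RHS]big_mkcond; apply: eq_bigr => p _.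
case: (p \in W); case: (p \in _);
  by rewrite ?(mul1r, mul0r, mulr0, add0r, expr0, expr1).
Qed.

(** The MacWilliams identity for an arbitrary function of the support: dual words are grouped by
    support and counted by [card_support_dual]. *)
Lemma support_sum_dual (hR : frobenius R) C (f : {set P} -> {poly rat}) :
    linear_code C ->
  #|C|%:R *: \sum_(v in dual_code C) f (support_mx v)
    = \sum_(u in C) \sum_W krawtchouk (support_mx u) W *: f W.
Proof.
move=> modC; rewrite (partition_big (@support_mx R n b) predT) //= scaler_sumr.
rewrite [RHS]exchange_big; apply: eq_bigr => W _ /=.
rewrite -scaler_suml -card_support_dual // natrM -scalerA; congr (_ *: _).
rewrite (eq_bigr (fun=> f W)) => [|v /andP[_ /eqP->] //].
rewrite (eq_bigl (fun v => v \in [set v in dual_code C | support_mx v == W])).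
  by rewrite sumr_const scaler_nat.
by move=> v; rewrite [RHS]inE.
Qed.

Definition byte_support W (i : 'I_n) : {set 'I_b} := [set j | (i, j) \in W].

Lemma hamming_weight_row v i :
  hamming_weight (row i v) = #|byte_support (support_mx v) i|.
Proof. by apply: eq_card => j; rewrite !inE mxE. Qed.

Lemma krawtchouk_bytes T W :
  krawtchouk T W = \prod_i krawtchouk (byte_support T i) (byte_support W i).
Proof.
rewrite /krawtchouk [LHS]big_mkcond.
under [RHS]eq_bigr => i _ do rewrite /krawtchouk big_mkcond.
rewrite pair_big; apply: eq_bigr => -[i j] _ /=.
by rewrite !inE.
Qed.

(** For a function multiplicative over bytes, the sum over all supports splits into independent sums
    over the support of each byte. *)
Lemma weight_sum_dual (hR : frobenius R) C (phi : nat -> {poly rat}) :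
    linear_code C ->
  #|C|%:R *: \sum_(v in dual_code C) \prod_i phi (hamming_weight (row i v))
    = \sum_(u in C) \prod_i \sum_(B : {set 'I_b})
        krawtchouk (byte_support (support_mx u) i) B *: phi #|B|.
Proof.
move=> modC; under eq_bigr => v _.
  under eq_bigr => i _ do rewrite hamming_weight_row.
over.
rewrite (support_sum_dual hR (fun W => \prod_i phi #|byte_support W i|) modC).
apply: eq_bigr => u _; rewrite bigA_distr_bigA.
(* [h] and [h'] identify sets of positions with families of byte supports. *)
pose h (W : {set P}) : {ffun 'I_n -> {set 'I_b}} := [ffun i => byte_support W i].
pose h' (g : {ffun 'I_n -> {set 'I_b}}) : {set P} := [set p | p.2 \in g p.1].
have hK : cancel h h' by move=> W; apply/setP => -[i j]; rewrite !inE ffunE inE.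
have h'K : cancel h' h.
  by move=> g; apply/ffunP => i; apply/setP => j; rewrite ffunE !inE.
rewrite [RHS](reindex h); last by exists h' => ? _.
apply: eq_bigr => W _; rewrite krawtchouk_bytes scaler_prod.
by congr (_ *: _); apply: eq_bigr => i _; rewrite ffunE.
Qed.

End WeightEnumerator.

(** * Evaluation of the sum over the supports of one byte *)

Lemma sum_subset_card (I : finType) (T : {set I}) (U : nmodType) (H : nat -> U) :
  \sum_(A : {set I} | A \subset T) H #|A|
    = \sum_(0 <= a < #|T|.+1) H a *+ 'C(#|T|, a).
Proof.
(* [inord] is faithful here, as [A \subset T] bounds [#|A|] by [#|T|]. *)
rewrite (partition_big (fun A : {set I} => inord #|A| : 'I_#|T|.+1) predT) //=.
rewrite big_mkord.
apply: eq_bigr => a _; rewrite -cards_draws -sumr_const.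
have eq_a (A : {set I}) : A \subset T -> (inord #|A| == a) = (#|A| == a).
  by move=> AT; rewrite -val_eqE /= inordK // ltnS subset_leq_card.
transitivity (\sum_(A : {set I} | (A \subset T) && (#|A| == a)) H #|A|).
  by apply: eq_bigl => A; case: (boolP (A \subset T)) => //= /eq_a.
by apply: eq_big => [A|A /andP[_ /eqP->] //]; rewrite inE.
Qed.

Lemma sum_set_split (I : finType) (T : {set I}) (U : nmodType)
    (G : {set I} -> {set I} -> U) :
  \sum_(B : {set I}) G (B :&: T) (B :\: T)
    = \sum_(A : {set I} | A \subset T) \sum_(A' : {set I} | A' \subset ~: T) G A A'.
Proof.
rewrite pair_big_dep.
rewrite (reindex_onto (fun p : {set I} * {set I} => p.1 :|: p.2)
  (fun B => (B :&: T, B :\: T))) => [|B _] /=; last by rewrite setID.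
apply: eq_big => [[A A']|[A A'] /eqP[-> ->] //] /=.
apply/eqP/andP => [[<- <-]|[AT A'T]].
  by rewrite subsetIr setDE subsetIr.
rewrite setIUl setDUl (setIidPl AT).
have -> : A' :&: T = set0 by apply/eqP; rewrite setI_eq0 disjoints_subset.
have -> : A :\: T = set0 by apply/eqP; rewrite setD_eq0.
by rewrite setU0 set0U setDE (setIidPl A'T).
Qed.

Lemma krawtchouk_cardE (R : finComPzRingType) (I : finType) (T B : {set I}) :
  krawtchouk R T B = (-1) ^+ #|B :&: T| * (#|R|%:R - 1) ^+ #|B :\: T|.
Proof.
rewrite /krawtchouk (big_setID T) /= -!prodr_const; congr (_ * _).
  by apply: eq_bigr => p /setIP[_ ->].
by apply: eq_bigr => p /setDP[_ /negPf->].
Qed.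

(** The summand depends only on [#|B :&: T|] and [#|B :\: T|], the indices [j1] and [j2] of
    [vartheta]; the binomials count the [B] with given values. *)
Lemma varthetaE (R : finComPzRingType) (t b : nat) (T : {set 'I_b}) :
  \sum_(B : {set 'I_b}) krawtchouk R T B *: 'X^(ceil_div #|B| t)
    = vartheta t b #|R| #|T|.
Proof.
pose G (a c : nat) : {poly rat} :=
  ((-1) ^+ a * (#|R|%:R - 1) ^+ c) *: 'X^(ceil_div (a + c) t).
transitivity (\sum_(B : {set 'I_b}) G #|B :&: T| #|B :\: T|).
  by apply: eq_bigr => B _; rewrite krawtchouk_cardE /G cardsID.
rewrite (sum_set_split T (fun A A' => G #|A| #|A'|)).
under eq_bigr => A _ do rewrite (sum_subset_card (~: T) (G #|A|)).
rewrite (sum_subset_card T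
  (fun a => \sum_(0 <= c < #|~: T|.+1) G a c *+ 'C(#|~: T|, c))).
have -> : #|~: T| = (b - #|T|)%N by rewrite cardsCs setCK card_ord.
apply: eq_bigr => a _; rewrite -sumrMnl; apply: eq_bigr => c _.
by rewrite /G -!scaler_nat !scalerA; congr (_ *: _); ring.
Qed.

(** * Grouping words by weight distribution, and the conclusion *)

Lemma sum_by_distribution (R : finComPzRingType) (n b : nat)
    (C : {set 'M[R]_(n, b)}) (psi : nat -> {poly rat}) :
  \sum_(v in C) \prod_i psi (hamming_weight (row i v))
    = \sum_(alpha : {ffun 'I_b.+1 -> 'I_n.+1} | (\sum_j alpha j == n)%N)
        (distribution_count C alpha)%:R *: \prod_(j < b.+1) psi j ^+ alpha j.
Proof.
(* No entry of a distribution exceeds [n], so [inord] loses nothing ([distE]). *)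
pose dist (v : 'M[R]_(n, b)) : {ffun 'I_b.+1 -> 'I_n.+1} :=
  [ffun j => inord (hamming_distribution v j)].
have distE v j : dist v j = hamming_distribution v j :> nat.
  by rewrite ffunE inordK // ltnS -[leqRHS]card_ord max_card.
pose wt (v : 'M[R]_(n, b)) i : 'I_b.+1 := inord (hamming_weight (row i v)).
have wtE v i : wt v i = hamming_weight (row i v) :> nat.
  by rewrite inordK // ltnS -[leqRHS]card_ord max_card.
have distI v j : hamming_distribution v j = #|[set i | wt v i == j]|.
  by apply: eq_card => i; rewrite !inE -val_eqE /= wtE.
rewrite (partition_big dist (fun alpha => (\sum_j alpha j == n)%N)) /= => [|v _].
  apply: eq_bigr => alpha _; rewrite /distribution_count scaler_nat -sumr_const.
  apply: eq_big => [v|v /andP[_ /eqP<-]].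
    rewrite inE; congr (_ && _); apply/eqP/forallP => [<- j|eqd].
      by rewrite distE.
    by apply/ffunP => j; apply/val_inj; rewrite /= distE; apply/eqP.
  rewrite (partition_big (wt v) predT) //=; apply: eq_bigr => j _.
  rewrite distE distI -prodr_const.
  by apply: eq_big => [i|i /eqP<-]; rewrite ?inE ?wtE.
(* Each of the [n] bytes has exactly one weight, so the entries add up to [n]. *)
apply/eqP; under eq_bigr => j _ do rewrite distE distI -sum1_card.
rewrite -[RHS](card_ord n) -sum1_card (partition_big (wt v) predT) //=.
by apply: eq_bigr => j _; apply: eq_bigl => i; rewrite inE.
Qed.

Theorem theorem3p12 (R : finComPzRingType) (hR : frobenius R)
    (b n t : nat) (hb : (1 <= b)%N) (hn : (1 <= n)%N)
    (ht : (1 <= t)%N) (htb : (t <= b)%N)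
    (C : {set 'M[R]_(n, b)}) (hC : linear_code C) :
  mspotty_enumerator t (dual_code C)
    = \sum_(alpha : {ffun 'I_b.+1 -> 'I_n.+1} | (\sum_j alpha j == n)%N)
        (distribution_count (dual_code C) alpha)%:R
          *: \prod_(j < b.+1) ('X^(ceil_div j t)) ^+ alpha j
  /\
  mspotty_enumerator t (dual_code C)
    = (#|C|%:R)^-1
        *: \sum_(alpha : {ffun 'I_b.+1 -> 'I_n.+1} | (\sum_j alpha j == n)%N)
             (distribution_count C alpha)%:R
               *: \prod_(j < b.+1) (vartheta t b #|R| j) ^+ alpha j.
Proof.
have enumE (D : {set 'M[R]_(n, b)}) : mspotty_enumerator t D
    = \sum_(v in D) \prod_i 'X^(ceil_div (hamming_weight (row i v)) t).
  by apply: eq_bigr => v _; rewrite expr_sum.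
split; first by rewrite enumE (sum_by_distribution _ (fun w => 'X^(ceil_div w t))).
rewrite -(sum_by_distribution C (vartheta t b #|R|)) enumE.
(* The code contains [0], so division by its cardinality is legitimate. *)
have C_neq0 : #|C|%:R != 0 :> rat.
  by rewrite pnatr_eq0 -lt0n; apply/card_gt0P; exists 0; exact: hC.1.
apply: (scalerI C_neq0); rewrite scalerA divff // scale1r.
rewrite (weight_sum_dual hR (fun w => 'X^(ceil_div w t)) hC).
apply: eq_bigr => u _; apply: eq_bigr => i _.
by rewrite varthetaE hamming_weight_row.
Qed.
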